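(* Let $A$ be a nontrivial ring with divisors with explicit divisibility. If $\mathfrak p$ is a nonzero finitely generated prime ideal of $A$ with $\pi=\mathrm{div}(\mathfrak p)>0$, then $\mathfrak p=\mathrm{Idv}(\mathfrak p)$ and $\pi$ is an irreducible divisor.
   Context: Rings are commutative with unit. A ring is integral if every element is zero or regular; $A^*$ is the set of regular elements, $K$ the total ring of fractions of $A$, $K^*$ its set of regular elements. An element $g\in A^*$ is a strong gcd of $(a_1,\dots,a_n)$ in $A^*$ if for every $x\in A^*$, $xg$ is a gcd of $(xa_1,\dots,xa_n)$ in $A$. A list $(a_i)$ in $A^*$ is divisorially invertible if there is a list $(b_j)$ in $A^*$ such that $(a_ib_j)_{i,j}$ has a strong gcd. An integral ring is a ring with divisors (PvMD) if every nonempty finite list in $A^*$ (equivalently every nonzero finitely generated ideal) is divisorially invertible. For a ring with divisors, $\mathrm{div}=\mathrm{div}_A:K^*\to\mathrm{Div}\,A$ is the (unique up to unique isomorphism) group morphism to a lattice-ordered group such that: $\mathrm{div}(x)\ge 0\iff x\in A$; and every element of $\mathrm{Div}\,A$ is the infimum of a finite family of elements $\mathrm{div}(x)$, $x\in K^*$. Elements of $\mathrm{Div}\,A$ are called divisors. Convention: $\mathrm{div}(0)=+\infty$. For a nonzero finitely generated ideal $\mathfrak a=\langle a_1,\dots,a_n\rangle$, $\mathrm{div}(\mathfrak a)=\bigwedge_i\mathrm{div}(a_i)$, which depends only on $\mathfrak a$. For $\alpha\in\mathrm{Div}\,A$, $\mathrm{Idv}(\alpha)=\{x\in K: \mathrm{div}(x)\ge\alpha\}$,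 and $\mathrm{Idv}(\mathfrak a)=\mathrm{Idv}(\mathrm{div}(\mathfrak a))$. The ring has explicit divisibility if divisibility in $A^*$ is decidable. An ideal is prime if the quotient satisfies $xy=0\Rightarrow x=0$ or $y=0$ (so $\langle1\rangle$ counts as prime). An element $\pi>0$ of a lattice-ordered group $G$ is irreducible if $\pi=\eta+\zeta$ with $\eta,\zeta\in G^+$ implies $\eta=0$ or $\zeta=0$. (The paper works in constructive mathematics in the style of Bishop.) *)

(* Defs.v *)
(* MathComp *)
From mathcomp Require Import all_boot all_order all_algebra.
From mathcomp Require Import fraction.

Set Implicit Arguments.
Unset Strict Implicit.
Unset Printing Implicit Defensive.

Import Order.TTheory GRing.Theory Num.Theory.

Local Open Scope ring_scope.

(* Nontrivial integral rings are [idomainType]s: regular means nonzero, [A^*] is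
   [{a | a != 0}], and the total ring of fractions is [{fraction A}]. *)

Section Divisibility.

Variable A : idomainType.

Definition divides (a b : A) : Prop := exists c, b = c * a.

Definition explicit_divisibility : Type :=
  forall a b : A, a != 0 -> b != 0 -> decidable (divides a b).

Definition regular_list (s : seq A) : Prop := {in s, forall a, a != 0}.

Definition is_gcd (g : A) (s : seq A) : Prop :=
  {in s, forall a, divides g a} /\
  forall y, {in s, forall a, divides y a} -> divides y g.

Definition strong_gcd (g : A) (s : seq A) : Prop :=
  g != 0 /\ forall x, x != 0 -> is_gcd (x * g) [seq x * a | a <- s].

Definition divisorially_invertible (s : seq A) : Prop :=
  exists t, regular_list t /\ exists g, strong_gcd g [seq a * b | a <- s, b <- t].

Definition ring_with_divisors : Prop :=
  forall s : seq A, s != [::] -> regular_list s -> divisorially_invertible s.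

End Divisibility.

Section Ideals.

Variable A : idomainType.

(* The ideal generated by the list [s]. *)
Definition fg_ideal (s : seq A) (x : A) : Prop :=
  exists c : 'I_(size s) -> A, x = \sum_(i < size s) c i * s`_i.

Definition nonzero_ideal (p : A -> Prop) : Prop := exists2 x, p x & x != 0.

(* The unit ideal is allowed. *)
Definition prime_ideal (p : A -> Prop) : Prop :=
  forall x y, p (x * y) -> p x \/ p y.

End Ideals.

(* Bundled by hand: an HB join of lattices and Z-modules would have to be declared
   before [realDomainType]. *)
Record latticeGroupType := LatticeGroup {
  lg_sort :> porderZmodType;
  lg_meet : lg_sort -> lg_sort -> lg_sort;
  lg_join : lg_sort -> lg_sort -> lg_sort;
  lg_lerD2l : forall x y z : lg_sort, x <= y -> z + x <= z + y;
  lg_lexI : forall x y z : lg_sort, (x <= lg_meet y z) = (x <= y) && (x <= z);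
  lg_leUx : forall x y z : lg_sort, (lg_join x y <= z) = (x <= z) && (y <= z)
}.

(* The infimum of the list; the value at [[::]] is junk. *)
Definition inf_list (G : latticeGroupType) (s : seq G) : G :=
  if s is x :: r then foldr (@lg_meet G) x r else 0.

Definition irreducible_elt (G : latticeGroupType) (pi : G) : Prop :=
  0 < pi /\
  forall eta zeta : G, 0 <= eta -> 0 <= zeta -> pi = eta + zeta ->
    eta = 0 \/ zeta = 0.

Section Divisors.

Variables (A : idomainType) (G : latticeGroupType).

(* [G] with [div] is the group of divisors of [A]. The map is only meaningful on
   [K^*]: its value at 0 is unconstrained, and the convention div(0) = +oo is
   built into [Idv] and [div_ideal] below. *)
Record is_divisor_map (div : {fraction A} -> G) : Prop := IsDivisorMap {
  divisor_mapM : forall x y, x != 0 -> y != 0 -> div (x * y) = div x + div y;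
  divisor_map_ge0 : forall x, x != 0 ->
    (0 <= div x <-> exists a : A, x = tofrac a);
  divisor_map_inf : forall alpha : G, exists s : seq {fraction A},
    [/\ s != [::], {in s, forall x, x != 0}
      & alpha = inf_list [seq div x | x <- s]]
}.

Variable div : {fraction A} -> G.

(* Zero generators, having divisor +oo, are neutral for the infimum. *)
Definition div_ideal (s : seq A) : G :=
  inf_list [seq div (tofrac a) | a <- s & a != 0].

Definition Idv (alpha : G) (x : {fraction A}) : Prop :=
  x = 0 \/ x != 0 /\ alpha <= div x.

Definition Idv_ideal (s : seq A) : {fraction A} -> Prop := Idv (div_ideal s).

End Divisors.

(* Main.v *)
(* By the axioms every divisor [alpha] is also a finite supremum of principal
   divisors, so [Idv alpha] is cut out by finitely many conditions [x z \in A];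
   hence it is a fractional ideal, and [p] is contained in [Idv pi].  If [a] lies
   in [Idv pi], then [a (a_i z) = (a z) a_i] lies in [p] for each generator [a_i]
   and each such [z]; were every [a_i z] in [p], each [z] would lie in [A], so
   [1 \in Idv pi] and [pi <= 0].  Thus [a] lies in [p].  If [pi = eta + zeta] with
   [eta = inf div x_i] and [zeta = inf div y_j], all [x_i y_j] lie in [Idv pi = p],
   so [p] contains every [x_i] or every [y_j], that is [eta >= pi] or
   [zeta >= pi]. *)
Require Import Defs.
From mathcomp Require Import all_boot all_order all_algebra.
From mathcomp Require Import fraction.

Set Implicit Arguments.
Unset Strict Implicit.
Unset Printing Implicit Defensive.

Import Order.TTheory GRing.Theory Num.Theory.

Local Open Scope ring_scope.

(** [Q] need not be decidable: the induction walks along the list and stops at the first entry for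
    which the hypothesis yields [Q]. *)
Lemma all_or_const (T : eqType) (P : T -> Prop) (Q : Prop) (t : seq T) :
  {in t, forall x, P x \/ Q} -> {in t, forall x, P x} \/ Q.
Proof.
elim: t => [|x t IHt] PQ; first by left.
have [Px|] := PQ x (mem_head x t); last by right.
have [|Pt|] := IHt; [|left|by right].
  by move=> y yt; apply: PQ; rewrite inE yt orbT.
by move=> y; rewrite inE => /orP[/eqP->|/Pt].
Qed.

Section LatticeGroup.

Variable G : latticeGroupType.
Implicit Types x y z : G.

Lemma lg_leD2lE z x y : (z + x <= z + y) = (x <= y).
Proof.
apply/idP/idP; last exact: lg_lerD2l.
by move/(lg_lerD2l (- z)); rewrite !addKr.
Qed.

Lemma lg_subr_leE x y z : (x - y <= z) = (x <= y + z).
Proof. by rewrite -(lg_leD2lE y (x - y)) addrCA subrr addr0. Qed.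

Lemma lg_leD x y z t : x <= y -> z <= t -> x + z <= y + t.
Proof.
move=> xy zt; apply: (@le_trans _ _ (x + t)); first by rewrite lg_leD2lE.
by rewrite ![_ + t]addrC lg_leD2lE.
Qed.

Lemma le_inf_list z (s : seq G) :
  s != [::] -> (z <= inf_list s) = all (<=%O z) s.
Proof.
case: s => //= x s _; elim: s => [|y s IHs] /=; first by rewrite andbT.
by rewrite lg_lexI IHs andbCA.
Qed.

Lemma sum_le_addend_eq0 x y : 0 <= y -> x + y <= x -> y = 0.
Proof.
by move=> y_ge0; rewrite -{2}[x]addr0 lg_leD2lE => y_le0; apply/le_anti/andP.
Qed.

End LatticeGroup.

Section FgIdeal.

Variables (A : idomainType) (s : seq A).

Lemma fg_ideal_mull c a : a \in s -> fg_ideal s (c * a).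
Proof.
move=> /(nthP 0)[i ltis <-].
exists (fun j : 'I_(size s) => if (j : nat) == i then c else 0).
rewrite (bigD1 (Ordinal ltis)) //= eqxx big1 ?addr0 // => j neq.
by rewrite ifN ?mul0r.
Qed.

Lemma nonzero_fg_ideal : nonzero_ideal (fg_ideal s) -> has (fun a => a != 0) s.
Proof.
case=> x [c ->]; apply: contraNT => /hasPn s0.
by rewrite big1 // => i _; move: (s0 _ (mem_nth 0 (ltn_ord i)));
  rewrite negbK => /eqP->; rewrite mulr0.
Qed.

End FgIdeal.

Section DivisorMap.

Variables (A : idomainType) (G : latticeGroupType) (div : {fraction A} -> G).
Hypothesis divP : is_divisor_map div.
Implicit Types (x y z : {fraction A}) (alpha : G) (s : seq A).

Lemma divisor_map1 : div 1 = 0.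
Proof.
apply: (@addrI _ (div 1)).
by rewrite -(divisor_mapM divP) ?oner_neq0 // mulr1 addr0.
Qed.

Lemma le_inf_divisors alpha (t : seq {fraction A}) : t != [::] ->
  (alpha <= inf_list [seq div x | x <- t]) <-> {in t, forall x, alpha <= div x}.
Proof.
move=> t_neq0; rewrite le_inf_list; last by case: t t_neq0.
by rewrite all_map; split=> [/allP//|h]; apply/allP.
Qed.

Lemma Idv_integral alpha x :
  0 <= alpha -> Idv div alpha x -> exists a : A, x = tofrac a.
Proof.
move=> a_ge0 [->|[x_neq0 /(le_trans a_ge0)]]; first by exists 0; rewrite tofrac0.
by move/(divisor_map_ge0 divP x_neq0).
Qed.

(* The inverses of the [z] have divisors with supremum [alpha]. *)
Lemma Idv_dual alpha : exists2 t : seq {fraction A}, {in t, forall z, z != 0} &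
  forall x, Idv div alpha x <->
    {in t, forall z, exists a : A, x * z = tofrac a}.
Proof.
(* With [- alpha] the infimum of the [div z], the condition [alpha <= div x] says that every
   [div x + div z] is nonnegative. *)
have [t [t_neq0 t_reg alphaE]] := divisor_map_inf divP (- alpha).
exists t => // x; have [->|x_neq0] := eqVneq x 0.
  by split=> [_ z _|_]; [exists 0; rewrite mul0r tofrac0|left].
have alphaP : (alpha <= div x) <-> {in t, forall z, 0 <= div (x * z)}.
  rewrite -[alpha]opprK alphaE -sub0r lg_subr_leE addrC -lg_subr_leE sub0r.
  apply: (iff_trans (le_inf_divisors _ t_neq0)); split=> h z zt; move: (h z zt);
  by rewrite -sub0r lg_subr_leE -(divisor_mapM divP) // t_reg.
have ge0P z zt := divisor_map_ge0 divP (mulf_neq0 x_neq0 (t_reg z zt)).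
split=> [[x0|[_ /alphaP h]] z zt|h]; first by rewrite x0 eqxx in x_neq0.
  exact/(ge0P z zt)/h.
right; split=> //; apply/alphaP => z zt; exact/(ge0P z zt)/h.
Qed.

(** The axioms on [div] do not mention sums; additivity comes from the dual description, since
    integrality of [x * z] is stable under addition. *)
Lemma IdvD alpha x y :
  Idv div alpha x -> Idv div alpha y -> Idv div alpha (x + y).
Proof.
have [t _ tP] := Idv_dual alpha; move=> /tP xt /tP yt; apply/tP => z zt.
have [[a xa] [b yb]] := (xt z zt, yt z zt).
by exists (a + b); rewrite mulrDl xa yb tofracD.
Qed.

Lemma IdvMl alpha (c : A) x : Idv div alpha x -> Idv div alpha (tofrac c * x).
Proof.
have [t _ tP] := Idv_dual alpha; move=> /tP xt; apply/tP => z zt.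
by have [a xa] := xt z zt; exists (c * a); rewrite -mulrA xa tofracM.
Qed.

(** A nonzero ideal has a nonzero generator, so the filtered list is nonempty and the junk value of
    [inf_list] is avoided. *)
Lemma le_div_ideal s alpha : nonzero_ideal (fg_ideal s) ->
  (alpha <= div_ideal div s) <->
  {in s, forall a, a != 0 -> alpha <= div (tofrac a)}.
Proof.
move=> /nonzero_fg_ideal s_neq0.
rewrite /div_ideal le_inf_list; last first.
  by rewrite -size_eq0 size_map size_filter -lt0n -has_count.
rewrite all_map; split=> [/allP h a sa a_neq0|h].
  by apply: h; rewrite mem_filter a_neq0.
by apply/allP => a; rewrite mem_filter => /andP[a_neq0 sa]; apply: h.
Qed.

Lemma generator_Idv_ideal s a :
  nonzero_ideal (fg_ideal s) -> a \in s -> Idv_ideal div s (tofrac a).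
Proof.
move=> s_neq0 sa; have [->|a_neq0] := eqVneq a 0; first by left; rewrite tofrac0.
right; rewrite tofrac_eq0; split=> //.
exact: (proj1 (le_div_ideal _ s_neq0) (lexx _)).
Qed.

Lemma fg_ideal_Idv_ideal s a :
  nonzero_ideal (fg_ideal s) -> fg_ideal s a -> Idv_ideal div s (tofrac a).
Proof.
move=> s_neq0 [c ->]; rewrite (big_morph _ (@tofracD A) (@tofrac0 A)).
apply: (big_ind (Idv_ideal div s)) => [||i _]; [by left|exact: IdvD|].
by rewrite tofracM; apply/IdvMl/generator_Idv_ideal/mem_nth.
Qed.

Lemma Idv_ideal_prime s a : nonzero_ideal (fg_ideal s) ->
  prime_ideal (fg_ideal s) -> 0 < div_ideal div s ->
  Idv_ideal div s (tofrac a) -> fg_ideal s a.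
Proof.
move=> s_neq0 s_prime pi_gt0 Idv_a.
have [t t_reg tP] := Idv_dual (div_ideal div s).
pose in_p z b := exists2 d, tofrac d = tofrac b * z & fg_ideal s d.
(* The alternative [fg_ideal s a] depends neither on [z] nor on [b], so it can be extracted from
   both finite quantifiers. *)
have in_p_or : {in t, forall z, {in s, forall b, in_p z b} \/ fg_ideal s a}.
  move=> z zt; apply: all_or_const => b sb.
  have [c cE] := proj1 (tP _) Idv_a z zt.
  have [d dE] := proj1 (tP _) (generator_Idv_ideal s_neq0 sb) z zt.
  (* In the fraction field [c = a z] and [d = b z], so both sides are [a b z]. *)
  have adE : a * d = c * b.
    by apply/eqP; rewrite -tofrac_eq !tofracM -dE -cE mulrCA mulrC.
  have [|pa|pd] := s_prime a d; first by rewrite adE; apply: fg_ideal_mull.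
    by right.
  by left; exists d.
have [t_in_p|//] := all_or_const in_p_or.
suff [/eqP|[_]] : Idv_ideal div s 1; first by rewrite oner_eq0.
  by rewrite divisor_map1 => /(lt_le_trans pi_gt0); rewrite ltxx.
apply/tP => z zt; rewrite mul1r; apply/(divisor_map_ge0 divP (t_reg z zt)).
(* The goal [0 <= div z] becomes [div_ideal div s - div z <= div_ideal div s]. It holds because [z]
   sends each generator into the ideal, hence into [Idv_ideal div s]. *)
rewrite -(lg_leD2lE (div_ideal div s)) addr0 [leRHS]addrC -lg_subr_leE.
apply/le_div_ideal => // b sb b_neq0; have [d dE pd] := t_in_p z zt b sb.
have bz_neq0 : tofrac b * z != 0 by rewrite mulf_neq0 ?tofrac_eq0 ?t_reg.
have := fg_ideal_Idv_ideal s_neq0 pd; rewrite dE => -[/eqP|[_]].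
  by rewrite (negPf bz_neq0).
by rewrite (divisor_mapM divP) ?tofrac_eq0 ?t_reg // lg_subr_leE addrC.
Qed.

End DivisorMap.

Theorem mainTheorem3 (A : idomainType)
    (A_div : ring_with_divisors A)
    (A_dvd : explicit_divisibility A)
    (DivA : latticeGroupType) (div : {fraction A} -> DivA)
    (divP : is_divisor_map div)
    (s : seq A)
    (p_neq0 : nonzero_ideal (fg_ideal s))
    (p_prime : prime_ideal (fg_ideal s))
    (pi_gt0 : 0 < div_ideal div s) :
  (forall x : {fraction A},
      (exists2 a : A, fg_ideal s a & x = tofrac a) <-> Idv_ideal div s x) /\
  irreducible_elt (div_ideal div s).
Proof.
have pE (x : {fraction A}) :
    (exists2 a : A, fg_ideal s a & x = tofrac a) <-> Idv_ideal div s x.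
  split=> [[a pa ->]|Idv_x]; first exact: fg_ideal_Idv_ideal.
  have [a xE] := Idv_integral divP (ltW pi_gt0) Idv_x.
  by exists a => //; apply: (Idv_ideal_prime divP); rewrite -?xE.
split=> //; split=> // eta zeta eta_ge0 zeta_ge0 piE.
have [t [t_neq0 t_reg etaE]] := divisor_map_inf divP eta.
have [u [u_neq0 u_reg zetaE]] := divisor_map_inf divP zeta.
have le_eta := proj1 (le_inf_divisors div eta t_neq0).
have le_zeta := proj1 (le_inf_divisors div zeta u_neq0).
rewrite -etaE -zetaE in le_eta le_zeta.
(* For fixed [x], the alternative on [x] is independent of [y] and leaves the quantifier over [u];
   what remains is independent of [x] and will leave the one over [t]. *)
have le_pi : {in t, forall x, {in u, forall y, div_ideal div s <= div y} \/
    div_ideal div s <= div x}.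
  move=> x xt; apply: all_or_const => y yu.
  have [/(_ _ xt) eta_x /(_ _ yu) zeta_y] := (le_eta (lexx _), le_zeta (lexx _)).
  have [x_neq0 y_neq0] := (t_reg x xt, u_reg y yu).
  (* Nonnegativity of [eta] and [zeta] puts [x] and [y] in [A], where primality can be applied. *)
  have [a xE] := proj1 (divisor_map_ge0 divP x_neq0) (le_trans eta_ge0 eta_x).
  have [b yE] := proj1 (divisor_map_ge0 divP y_neq0) (le_trans zeta_ge0 zeta_y).
  have : Idv_ideal div s (x * y).
    right; rewrite mulf_neq0 //; split=> //.
    by rewrite piE (divisor_mapM divP) //; apply: lg_leD.
  move=> /pE[c pc]; rewrite xE yE -tofracM => /eqP; rewrite tofrac_eq => /eqP cE.
  rewrite -cE in pc; case/p_prime: pc => /(fg_ideal_Idv_ideal divP p_neq0).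
    by rewrite -xE => -[/eqP|[_ ?]]; [rewrite (negPf x_neq0)|right].
  by rewrite -yE => -[/eqP|[_ ?]]; [rewrite (negPf y_neq0)|left].
have [|pi_eta|pi_zeta] := @all_or_const _ (fun x => div_ideal div s <= div x)
  {in u, forall y, div_ideal div s <= div y} t.
- by move=> x /le_pi[|]; [right|left].
(* The bound on all of [t] gives [eta + zeta <= eta], so it is the other summand that vanishes. *)
- right; apply: (@sum_le_addend_eq0 _ eta) => //; rewrite -piE etaE.
  exact/le_inf_divisors.
left; apply: (@sum_le_addend_eq0 _ zeta) => //; rewrite addrC -piE zetaE.
exact/le_inf_divisors.
Qed.
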